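(* Let $(X,\delta)$ be an approach space. Then $(X,\delta)$ is normal if and only if it satisfies separation by Urysohn contractive maps.
   Context: A distance on a set $X$ is a function $\delta:X\times 2^X\to[0,\infty]$ such that for all $x\in X$, $A,B\subseteq X$, $\varepsilon\in[0,\infty]$: (D1) $\delta(x,\{x\})=0$; (D2) $\delta(x,\emptyset)=\infty$; (D3) $\delta(x,A\cup B)=\min\{\delta(x,A),\delta(x,B)\}$; (D4) $\delta(x,A)\le\delta(x,A^{(\varepsilon)})+\varepsilon$, where $A^{(\varepsilon)}=\{x\in X\mid\delta(x,A)\le\varepsilon\}$. The pair $(X,\delta)$ is an approach space. A map $f:(X,\delta_X)\to(Y,\delta_Y)$ between approach spaces is a contraction if $\delta_Y(f(x),f(A))\le\delta_X(x,A)$ for all $x\in X$, $A\subseteq X$. For a set $Z$ with a metric or quasi-metric $d$, $\delta_d(z,A)=\inf_{a\in A}d(z,a)$ is the associated distance; $d_{\mathbb E}(x,y)=|x-y|$ is the Euclidean metric. Separation: for a real $\gamma>0$, two sets $A,B\subseteq X$ are $\gamma$-separated if $A^{(\alpha)}\cap B^{(\beta)}=\emptyset$ whenever $\alpha\ge0$, $\beta\ge0$ and $\alpha+\beta<\gamma$. Contractive scale: a map $F:\mathbb Q\to 2^X$ with $\bigcup_{q\in\mathbb Q}F(q)=X$ and $\bigcap_{q\in\mathbb Q}F(q)=\emptyset$ such that for all $r,s\in\mathbb Q$ with $r<s$, the sets $F(r)$ and $X\setminus F(s)$ are $(s-r)$-separated. Normality: $(X,\delta)$ is normal if for all $A,B\subseteq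 X$ and all real $\gamma>0$ with $A$ and $B$ $\gamma$-separated, there exists a contractive scale $F$ such that (i) $F(q)=\emptyset$ for all rational $q<0$; (ii) $A\subseteq\bigcap_{q\in\mathbb Q,\,q\ge0}F(q)$; (iii) $B\cap\bigcup_{r\in\mathbb Q\cap\,]0,\gamma]}F(r)=\emptyset$. Separation by Urysohn contractive maps: for all $A,B\subseteq X$ and every real $\gamma>0$, whenever $A$ and $B$ are $\gamma$-separated, there exists a contraction $f:(X,\delta)\to([0,\gamma],\delta_{d_{\mathbb E}})$ with $f(a)=\gamma$ for $a\in A$ and $f(b)=0$ for $b\in B$. *)

(* Defs.v *)
From mathcomp Require Import all_boot all_order all_algebra.
From mathcomp Require Import all_classical all_reals ereal.

Set Implicit Arguments.
Unset Strict Implicit.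
Unset Printing Implicit Defensive.

Import Order.TTheory GRing.Theory Num.Theory.

Local Open Scope classical_set_scope.
Local Open Scope ring_scope.
Local Open Scope ereal_scope.

Definition enlargement (R : realType) (T : Type) (delta : T -> set T -> \bar R)
  (A : set T) (e : \bar R) : set T := [set x | delta x A <= e].

Record is_distance (R : realType) (T : Type) (delta : T -> set T -> \bar R) :
    Prop := IsDistance {
  distance_ge0 : forall x A, 0 <= delta x A ;
  distance_self : forall x, delta x [set x] = 0 ;
  distance_set0 : forall x, delta x set0 = +oo ;
  distance_setU : forall x A B,
    delta x (A `|` B) = Order.min (delta x A) (delta x B) ;
  distance_enlargement : forall x A (e : \bar R), 0 <= e ->
    delta x A <= delta x (enlargement delta A e) + e }.

Record approachSpace (R : realType) := ApproachSpace {
  point :> Type ;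
  dist : point -> set point -> \bar R ;
  dist_axioms : is_distance dist }.

Definition approach_contraction (R : realType) (X Y : approachSpace R) (f : X -> Y) :
    Prop :=
  forall (x : X) (A : set X), dist (f x) (f @` A) <= dist x A.

Definition metric_dist (R : realType) (Z : Type) (d : Z -> Z -> \bar R)
  (z : Z) (A : set Z) : \bar R := ereal_inf [set d z a | a in A].

(* Symmetry and separation of points are not assumed, so this covers
   quasi-metrics, including extended ones. *)
Lemma metric_dist_is_distance (R : realType) (Z : Type) (d : Z -> Z -> \bar R) :
  (forall x y, 0 <= d x y) -> (forall x, d x x = 0) ->
  (forall x y z, d x z <= d x y + d y z) ->
  is_distance (metric_dist d).
Proof.
move=> d0 dxx dtri.
have ge0 x A : 0 <= metric_dist d x A.
  by apply: le_ereal_inf_tmp => _ [a _ <-].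
split => //.
- by move=> x; rewrite /metric_dist image_set1 ereal_inf1.
- by move=> x; rewrite /metric_dist image_set0 ereal_inf0.
- move=> x A B; apply/le_anti/andP; split.
    rewrite le_min; apply/andP; split; apply: ereal_inf_le_tmp;
      by apply: image_subset; (exact: subsetUl || exact: subsetUr).
  apply: le_ereal_inf_tmp => _ [a [Aa|Ba] <-]; rewrite ge_min; apply/orP.
    by left; apply: ereal_inf_lbound; exists a.
  by right; apply: ereal_inf_lbound; exists a.
- move=> x A [e| |] //= e0; last first.
    by rewrite addey ?leey// gt_eqF// (lt_le_trans _ (ge0 _ _)) ?ltNy0.
  rewrite -leeBlDr//; apply: le_ereal_inf_tmp => _ [b Ab <-].
  rewrite leeBlDr//; apply/lee_addgt0Pr => t t0.
  have : metric_dist d b A < (e + t)%:E.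
    by apply: le_lt_trans Ab _; rewrite lte_fin ltrDl.
  move=> /ereal_inf_lt[_ [a Aa <-] dba].
  apply: (@le_trans _ _ (d x a)); first by apply: ereal_inf_lbound; exists a.
  apply: (le_trans (dtri x b a)).
  by rewrite -addeA -EFinD; apply: leeD => //; exact: ltW.
Qed.

Definition euclidean (R : realType) (x y : R) : \bar R := `|x - y|%R%:E.

Definition interval_dist (R : realType) (gamma : R) :=
  metric_dist (fun x y : {t : R | t \in `[0%R, gamma]} =>
    euclidean (val x) (val y)).

Lemma interval_dist_is_distance (R : realType) (gamma : R) :
  is_distance (@interval_dist R gamma).
Proof.
apply: metric_dist_is_distance => [x y|x|x y z]; rewrite /euclidean.
- by rewrite lee_fin normr_ge0.
- by rewrite subrr normr0.
- by rewrite -EFinD lee_fin ler_distD.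
Qed.

Definition interval_space (R : realType) (gamma : R) : approachSpace R :=
  ApproachSpace (interval_dist_is_distance gamma).

Definition gamma_separated (R : realType) (X : approachSpace R) (gamma : R)
    (A B : set X) : Prop :=
  forall alpha beta : R,
    (0 <= alpha)%R -> (0 <= beta)%R -> (alpha + beta < gamma)%R ->
    enlargement (@dist R X) A alpha%:E `&` enlargement (@dist R X) B beta%:E
      = set0.

Record contractive_scale (R : realType) (X : approachSpace R)
    (F : rat -> set X) : Prop := ContractiveScale {
  scale_bigcup : \bigcup_q F q = setT ;
  scale_bigcap : \bigcap_q F q = set0 ;
  scale_separated : forall r s : rat, (r < s)%R ->
    gamma_separated (ratr (s - r)%R) (F r) (~` F s) }.

Definition approach_normal (R : realType) (X : approachSpace R) : Prop :=
  forall (A B : set X) (gamma : R), (0 < gamma)%R -> gamma_separated gamma A B ->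
    exists F : rat -> set X,
      [/\ contractive_scale F,
          forall q : rat, (q < 0)%R -> F q = set0,
          A `<=` \bigcap_(q in [set q : rat | (0 <= q)%R]) F q
        & B `&` \bigcup_(r in [set r : rat | (0 < r)%R /\
                                             (ratr r <= gamma)%R]) F r
            = set0].

Definition urysohn_separation (R : realType) (X : approachSpace R) : Prop :=
  forall (A B : set X) (gamma : R), (0 < gamma)%R -> gamma_separated gamma A B ->
    exists f : X -> interval_space gamma,
      [/\ approach_contraction f,
          forall a, A a -> val (f a) = gamma
        & forall b, B b -> val (f b) = 0%R].

(* Main.v *)
Require Import Defs.
From mathcomp Require Import all_boot all_order all_algebra.
From mathcomp Require Import all_classical all_reals ereal.
From mathcomp Require Import lra.

(** A function [g : X -> R] is a contraction exactly when, for all reals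
    [r < s], its level sets [{g <= r}] and [{g >= s}] are [(s - r)]-separated
    ([line_contractionP]).  The content is one observation: if no point of [A]
    has a value within [e] of [g x], then [A] is the union of a part in
    [{g <= g x - e}] and a part in [{g >= g x + e}], and by (D3) the distance
    from [x] to [A] is attained on one of them, from which [x] is separated.
    So contractive scales are the rational traces of real contractions.

    From a scale to a map: [level F x], the infimum of the rationals [q] with
    [F q x], has level sets [{level <= r}] inside [F r'] for [r' > r] and
    [{level >= s}] outside [F s'] for [s' < s].  Letting [r'] and [s'] tend to
    [r] and [s] gives the separation of the level sets, so [level F] is a
    contraction; it vanishes on [A] and is at least [gamma] on [B], and
    [gamma - min (level F x) gamma] is the Urysohn map.

    From a map to a scale: [g = gamma - f] is a contraction which is [0] on [A]
    and [gamma] on [B], and any family [F] lying between [{g < q}] and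
    [{g <= q}] inherits separation from the level sets of [g].  The choice
    between the two is dictated by the boundary conditions on [A] and [B]. *)

Set Implicit Arguments.
Unset Strict Implicit.
Unset Printing Implicit Defensive.

Import Order.TTheory GRing.Theory Num.Theory.

Local Open Scope classical_set_scope.
Local Open Scope ring_scope.

(** * Distances and separated sets *)

Section ApproachSpaces.
Variables (R : realType) (X : approachSpace R).
Implicit Types (A B : set X) (x : X).

Lemma dist_subset x A B : A `<=` B -> (dist x B <= dist x A)%E.
Proof.
move=> AB; rewrite -(setUidr AB) (distance_setU (dist_axioms X)).
by rewrite ge_min lexx.
Qed.

Lemma dist_mem x A : A x -> dist x A = 0%E.
Proof.
move=> Ax; apply/le_anti/andP; split; last exact: distance_ge0 (dist_axioms X) _ _.
rewrite -(distance_self (dist_axioms X) x).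
by apply: dist_subset => _ ->.
Qed.

Lemma gamma_separatedP (gamma : R) A B :
  gamma_separated gamma A B <->
  forall x (a b : R), 0 <= a -> 0 <= b -> (dist x A <= a%:E)%E ->
    (dist x B <= b%:E)%E -> gamma <= a + b.
Proof.
split=> [sep x a b a0 b0 xA xB|sep a b a0 b0 abg].
  rewrite leNgt; apply/negP => abg.
  have := sep _ _ a0 b0 abg; rewrite -subset0 => /(_ x); apply; split.
    exact: xA.
  exact: xB.
rewrite -subset0 => x [xA xB].
by have := sep x a b a0 b0 xA xB; rewrite leNgt abg.
Qed.

(** A point of [A] is at distance [0] from [A], so the whole of [gamma] has to
    be covered on the side of [B]. *)
Lemma separated_dist_ge (gamma : R) A B x (b : R) :
  gamma_separated gamma A B -> 0 <= b -> A x -> (dist x B <= b%:E)%E ->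
  gamma <= b.
Proof.
move=> /gamma_separatedP sep b0 Ax xB; rewrite -[b]add0r.
by apply: sep xB => //; rewrite dist_mem.
Qed.

Lemma gamma_separatedC (gamma : R) A B :
  gamma_separated gamma A B -> gamma_separated gamma B A.
Proof.
by move=> sep a b a0 b0 ab; rewrite setIC; apply: sep; rewrite // addrC.
Qed.

Lemma gamma_separatedS (gamma : R) A A' B B' : A `<=` A' -> B `<=` B' ->
  gamma_separated gamma A' B' -> gamma_separated gamma A B.
Proof.
move=> AA BB /gamma_separatedP sep; apply/gamma_separatedP => x a b a0 b0 xA xB.
by apply: (sep x) => //; [exact: le_trans (dist_subset _ AA) xA
                        | exact: le_trans (dist_subset _ BB) xB].
Qed.

Lemma gamma_separated_le (gamma t : R) A B :
  t <= gamma -> gamma_separated gamma A B -> gamma_separated t A B.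
Proof.
by move=> tg sep a b a0 b0 abt; apply: sep => //; apply: lt_le_trans tg.
Qed.

Lemma gamma_separated_sup (gamma : R) A B :
  (forall t, 0 < t < gamma -> gamma_separated t A B) -> gamma_separated gamma A B.
Proof.
move=> sep a b a0 b0 abg; apply: (sep ((a + b + gamma) / 2)) => //; lra.
Qed.

End ApproachSpaces.

(** * Real-valued contractions and their level sets *)

Section RealContractions.
Variables (R : realType) (X : approachSpace R).
Implicit Types (g : X -> R) (A : set X) (x : X).

Definition line_dist : R -> set R -> \bar R := metric_dist (@euclidean R).

Definition line_contraction g : Prop :=
  forall x A, (line_dist (g x) (g @` A) <= dist x A)%E.

Lemma line_dist_image g x A (e t : R) :
  (line_dist (g x) (g @` A) <= e%:E)%E -> e < t ->
  exists2 a, A a & `|g x - g a| < t.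
Proof.
move=> le_e et; have : (line_dist (g x) (g @` A) < t%:E)%E.
  by apply: le_lt_trans le_e _; rewrite lte_fin.
move=> /ereal_inf_lt[_ [_ [a Aa <-] <-]]; rewrite lte_fin => lt_t.
by exists a.
Qed.

(** If [g] is a contraction, then a point within [a] of [{g <= r}] has
    [g x <= r + a], and one within [b] of [{g >= s}] has [g x >= s - b], so
    both can hold only if [s - r <= a + b].  Conversely, separation bounds from
    below the distance from [x] to the points with values far below, or far
    above, [g x]. *)
Lemma line_contractionP g :
  line_contraction g <->
  forall r s : R, r < s ->
    gamma_separated (s - r) [set x | g x <= r] [set x | s <= g x].
Proof.
split=> [gc r s rs|sep x A].
  apply/gamma_separatedP => x a b a0 b0 xr xs.
  apply/ler_addgt0Pr => t t0; have t20 : 0 < t / 2 by rewrite divr_gt0.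
  have [y /= yr] := line_dist_image (le_trans (gc _ _) xr) (ltr_pwDr t20 (lexx a)).
  have [z /= zs] := line_dist_image (le_trans (gc _ _) xs) (ltr_pwDr t20 (lexx b)).
  rewrite !ltr_norml => /andP[? ?] /andP[? ?]; lra.
have d0 := distance_ge0 (dist_axioms X) x A.
case dxA : (dist x A) d0 => [d| |] // d0; last exact: leey.
rewrite lee_fin in d0.
apply/lee_addgt0Pr => t t0; rewrite -EFinD.
have [[a Aa lt_a]|far] := pselect (exists2 a, A a & `|g x - g a| < d + t).
  apply: (@le_trans _ _ `|g x - g a|%:E); last by rewrite lee_fin ltW.
  by apply: ereal_inf_lbound; exists (g a) => //; exists a.
pose Al := [set a | g a <= g x - (d + t)].
pose Ar := [set a | g x + (d + t) <= g a].
have Alr : A `<=` Al `|` Ar.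
  move=> a Aa; have : d + t <= `|g x - g a|.
    by rewrite leNgt; apply/negP => lt_a; apply: far; exists a.
  by rewrite ler_normr => /orP[?|?]; [left|right]; rewrite /Al /Ar /=; lra.
have := dist_subset x Alr; rewrite dxA (distance_setU (dist_axioms X)) ge_min.
case/orP => close; exfalso.
  suff : g x - (g x - (d + t)) <= d by lra.
  apply: (separated_dist_ge (gamma_separatedC (sep _ _ _)) d0 _ close) => //=.
  lra.
suff : g x + (d + t) - g x <= d by lra.
apply: (separated_dist_ge (sep _ _ _) d0 _ close) => //=.
lra.
Qed.

Lemma line_contraction_comp (phi : R -> R) g :
  (forall u v, `|phi u - phi v| <= `|u - v|) ->
  line_contraction g -> line_contraction (phi \o g).
Proof.
move=> phi1 gc x A; apply: le_trans (gc x A).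
apply: le_ereal_inf_tmp => _ [_ [a Aa <-] <-].
apply: (@le_trans _ _ `|phi (g x) - phi (g a)|%:E); last by rewrite lee_fin.
by apply: ereal_inf_lbound; exists (phi (g a)) => //; exists a.
Qed.

Lemma interval_contractionP (gamma : R) (f : X -> interval_space gamma) :
  approach_contraction f <-> line_contraction (fun x => val (f x)).
Proof.
suff E x A : dist (f x) (f @` A) =
    line_dist (val (f x)) ((fun y => val (f y)) @` A).
  by split=> fc x A; have := fc x A; rewrite E.
by rewrite /= /interval_dist /line_dist /metric_dist !image_comp.
Qed.

End RealContractions.

(** * Contractive scales and real contractions *)

Section Scales.
Variables (R : realType) (X : approachSpace R).
Implicit Types (F : rat -> set X) (x : X).

Lemma scale_subset F (r s : rat) :
  contractive_scale F -> r < s -> F r `<=` F s.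
Proof.
move=> Fs rs x Frx; apply: contrapT => nFsx.
have := separated_dist_ge (scale_separated Fs rs) (lexx 0) Frx.
rewrite dist_mem // => /(_ (lexx _)).
by rewrite leNgt ltr0q subr_gt0 rs.
Qed.

Definition level F x : R := inf [set (ratr q : R) | q in [set q | F q x]].

Section Level.
Variable F : rat -> set X.
Hypothesis Fs : contractive_scale F.

Lemma level_nonempty x : [set (ratr q : R) | q in [set q | F q x]] !=set0.
Proof.
have : setT x by []; rewrite -(scale_bigcup Fs) => -[q _ Fqx].
by exists (ratr q), q.
Qed.

(** The scale has empty intersection, so some [p] has [x] outside [F p], and
    monotonicity makes [p] a lower bound. *)
Lemma level_has_lbound x : has_lbound [set (ratr q : R) | q in [set q | F q x]].
Proof.
have [p nFpx] : exists p, ~ F p x.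
  apply/existsNP => allF.
  have : (\bigcap_q F q) x by move=> q _; exact: allF.
  by rewrite (scale_bigcap Fs).
exists (ratr p) => _ [q Fqx <-]; rewrite ler_rat leNgt; apply/negP => qp.
exact: nFpx (scale_subset Fs qp Fqx).
Qed.

Lemma level_le q x : F q x -> level F x <= ratr q.
Proof. by move=> Fqx; apply: ge_inf; [exact: level_has_lbound | exists q]. Qed.

Lemma le_level (s : R) x : (forall q, F q x -> s <= ratr q) -> s <= level F x.
Proof.
by move=> sF; apply: lb_le_inf; [exact: level_nonempty | move=> _ [q /sF ? <-]].
Qed.

Lemma level_lt q x : level F x < ratr q -> F q x.
Proof.
move=> /(inf_lt (level_nonempty x))[_ [p Fpx <-]]; rewrite ltr_rat => pq.
exact: scale_subset pq _ Fpx.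
Qed.

(** [{level F <= r}] need not be contained in [F r], but it is in every later
    [F r'], and dually for [{level F >= s}]; hence rationals [r'] and [s']
    slightly inside the interval from [r] to [s], and a separation constant
    approached from below. *)
Lemma level_contraction : line_contraction (level F).
Proof.
apply/line_contractionP => r s rs; apply: gamma_separated_sup => t /andP[t0 tsr].
pose h : R := (s - r - t) / 2.
have h0 : 0 < h by rewrite /h; lra.
have [r' /[!in_itv]/= /andP[rr' r'r]] : exists q : rat, ratr q \in `]r, (r + h)[.
  by apply: rat_in_itvoo; lra.
have [s' /[!in_itv]/= /andP[ss' s's]] : exists q : rat, ratr q \in `](s - h), s[.
  by apply: rat_in_itvoo; lra.
have tr's' : t < ratr (s' - r') by rewrite rmorphB /=; rewrite /h in r'r ss'; lra.
have r's' : r' < s' by rewrite -(ltr_rat R) -subr_gt0 -rmorphB /=; lra.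
apply: gamma_separated_le (ltW tr's') _.
apply: gamma_separatedS (scale_separated Fs r's') => y /= ly.
  by apply: level_lt; apply: le_lt_trans rr'.
by move=> /level_le; lra.
Qed.

End Level.

(** The slack between the two bounds on [F q] costs nothing: the sets [F r] and
    [~` F s] lie in the closed level sets [{g <= r}] and [{g >= s}] whichever
    inequality is used at the boundary. *)
Lemma contraction_scale F (g : X -> R) : line_contraction g ->
  (forall q, [set x | g x < ratr q] `<=` F q) ->
  (forall q, F q `<=` [set x | g x <= ratr q]) -> contractive_scale F.
Proof.
move=> gc ltF Fle; split.
- rewrite -subTset => x _.
  have [q /[!in_itv]/= /andP[gq _]] : exists q : rat, ratr q \in `](g x), (g x + 1)[.
    by apply: rat_in_itvoo; rewrite ltrDl.
  by exists q => //; apply: ltF.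
- rewrite -subset0 => x Fx.
  have [q /[!in_itv]/= /andP[_ qg]] : exists q : rat, ratr q \in `](g x - 1), (g x)[.
    by apply: rat_in_itvoo; lra.
  by have := Fle _ _ (Fx q I); rewrite /= leNgt qg.
- move=> r s rs; rewrite rmorphB /=.
  have rs' : ratr r < ratr s :> R by rewrite ltr_rat.
  apply: gamma_separatedS (iffLR (line_contractionP g) gc _ _ rs'); first exact: Fle.
  by move=> x nFx /=; rewrite leNgt; apply/negP => /ltF.
Qed.

End Scales.

(** * Normality and Urysohn maps *)

Section Urysohn.
Variables (R : realType) (X : approachSpace R).

Lemma normal_urysohn : approach_normal X -> urysohn_separation X.
Proof.
move=> nX A B gamma gamma0 /(nX _ _ _ gamma0)[F [Fs Fneg AF BF]].
pose phi (u : R) := gamma - Num.min u gamma.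
have level_ge0 x : 0 <= level F x.
  apply: le_level => // q Fqx; rewrite ler0q leNgt; apply/negP => /Fneg Fq0.
  by rewrite Fq0 in Fqx.
have fP x : phi (level F x) \in `[0, gamma].
  rewrite in_itv /= /phi subr_ge0 ge_min lexx orbT /= gerBl le_min.
  by rewrite level_ge0 ltW.
exists (fun x => exist _ (phi (level F x)) (fP x)); split.
- apply/interval_contractionP => /=.
  apply: (@line_contraction_comp R X phi); last exact: level_contraction.
  move=> u v; have := ler_norm (u - v); have := ler_norm (v - u).
  rewrite (distrC v) ler_norml /phi => ? ?.
  by apply/andP; split; case: (leP u gamma) => ?; case: (leP v gamma) => ?; lra.
- move=> a Aa /=; suff -> : level F a = 0.
    by rewrite /phi (min_idPl (ltW gamma0)) subr0.
  apply/le_anti; rewrite level_ge0 andbT -[leRHS](@ratr_nat R 0).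
  exact: level_le (AF _ Aa 0 (lexx 0)).
- move=> b Bb /=; suff le_level_b : gamma <= level F b.
    by rewrite /phi (min_idPr le_level_b) subrr.
  (* If the level were below [gamma], a rational [q] strictly between the two
     would have [F q b]; it is positive because levels are nonnegative. *)
  rewrite leNgt; apply/negP => lt_gamma.
  have [q /[!in_itv]/= /andP[lq qgamma]] := rat_in_itvoo lt_gamma.
  have : (B `&` \bigcup_(r in [set r : rat | 0 < r /\ ratr r <= gamma]) F r) b.
    split=> //; exists q; last exact: level_lt.
    by split; [rewrite -(ltr0q R); exact: le_lt_trans lq | exact: ltW].
  by rewrite BF.
Qed.

Lemma urysohn_normal : urysohn_separation X -> approach_normal X.
Proof.
move=> uX A B gamma gamma0 /(uX _ _ _ gamma0)[f [fc fA fB]].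
pose g x := gamma - val (f x).
have g_ge0 x : 0 <= g x.
  by rewrite subr_ge0; have := valP (f x); rewrite in_itv /= => /andP[].
have gc : line_contraction g.
  apply: (@line_contraction_comp R X (fun u => gamma - u)).
    by move=> u v; rewrite distrC (_ : _ - _ = u - v) //; lra.
  exact/interval_contractionP.
(* [A], where [g] is [0], must lie in [F 0], whereas [B], where [g] is [gamma],
   must avoid [F gamma] when [gamma] is rational: hence the weak inequality
   at the value [0] and the strict one elsewhere. *)
pose F (q : rat) := [set x | 0 <= q /\ (g x = 0 \/ g x < ratr q)].
exists F; split.
- apply: contraction_scale gc _ _ => q x /=.
    move=> gq; split; last by right.
    by rewrite -(ler0q R); apply: le_trans (g_ge0 x) (ltW gq).
  by move=> [q0 [->|/ltW //]]; rewrite ler0q.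
- move=> q q0; rewrite -subset0 => x [] /=; by rewrite leNgt q0.
- by move=> a Aa q /= q0; split=> //; left; rewrite /g fA // subrr.
- rewrite -subset0 => b [Bb [r [r0 rgamma] [_]]].
  by rewrite /g fB // subr0 => -[|]; lra.
Qed.

End Urysohn.

Theorem theorem3p8 (R : realType) (X : approachSpace R) :
  approach_normal X <-> urysohn_separation X.
Proof. by split; [exact: normal_urysohn | exact: urysohn_normal]. Qed.
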